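(* Let $(H,\mathcal B)$ be an ARN-hypergroup. The following are equivalent: 1. The hypergroup $(H,\mathcal B)$ is dual-Burnside. 2. The following identity holds in $H$: $$\Big(\prod_{i=1}^m\frac{x_i}{d_i}\Big)^2=\frac{1}{n\big((H,\mathcal B)_{ad}\big)}\Big(\sum_{x_i\in\mathcal B_{ad}}h_i\,d_{i^*}\,x_i\Big).$$
   Context: ARN-hypergroup (abelian real non-negative hypergroup) $(H,\mathcal B)$: a finite-dimensional commutative unital associative $\mathbb C$-algebra $H$ with a $\mathbb C$-basis $\mathcal B=\{x_1=1,\dots,x_m\}$, $x_ix_j=\sum_kN_{i,j}^kx_k$ with $N_{i,j}^k\in\mathbb R_{\ge0}$, and an involution $i\mapsto i^*$ of $\{1,\dots,m\}$ such that $N_{i,i^*}^1>0$ and $N_{i,j}^1=0$ if $j\ne i^*$. Standing assumption: $x_i\mapsto x_{i^*}$ extends to an anti-involution of $H$, i.e. $N_{i,j}^k=N_{j^*,i^*}^{k^*}$. Put $h_i:=1/N_{i,i^*}^1$. $\mathrm{FPdim}:H\to\mathbb C$ is the unique algebra morphism with positive values on $\mathcal B$ ($\mathrm{FPdim}(x_i)$ is the Frobenius–Perron eigenvalue of left multiplication by $x_i$); $d_i:=\mathrm{FPdim}(x_i)$. $\widehat{\mathcal B}=\{\mu_1=\mathrm{FPdim},\mu_2,\dots,\mu_m\}$ is the set of all unital algebra morphisms $H\to\mathbb C$, a basis of $H^*$. Dual hypergroup $\widehat{(H,\mathcal B)}$: $H^*$ with basis $\widehat{\mathcal B}$, product $(f\star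 g)(x_i/d_i)=f(x_i/d_i)g(x_i/d_i)$ for all $i$, unit $\mu_1$, involution $\mu_{j^\#}(x_i)=\mu_j(x_{i^*})$; write $\mu_i\star\mu_j=\sum_k\widehat p_k(i,j)\mu_k$. $\mu_j$ is grouplike in the dual if $\mu_j\star\mu_{j^\#}=\widehat p_1(j,j^\#)\mu_1$. $(H,\mathcal B)$ is dual-Burnside if for every $\mu_j\in\widehat{\mathcal B}$: there is $x_i\in\mathcal B$ with $\mu_j(x_i)=0$ if and only if $\mu_j$ is not grouplike in the dual. Adjoint sub-hypergroup: $\mathcal B_{ad}\subseteq\mathcal B$ is the set of all standard elements occurring with non-zero coefficient in some power ($n\ge1$) of $I(1)=\sum_ih_ix_ix_{i^*}$; $(H,\mathcal B)_{ad}$ is its linear span with basis $\mathcal B_{ad}$, and $n((H,\mathcal B)_{ad})=\sum_{x_i\in\mathcal B_{ad}}h_id_i^2$. *)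

(* Defs.v *)
From HB Require Import structures.
From mathcomp Require Import all_boot all_order all_algebra all_field.
From mathcomp Require Import boolp classical_sets reals.
From mathcomp Require Export complex.
Set Implicit Arguments.
Unset Strict Implicit.
Unset Printing Implicit Defensive.
Import Order.TTheory GRing.Theory Num.Theory.
Local Open Scope ring_scope.

(* The basis is indexed by 'I_n.+1, and [ord0] is the index of the unit.
   In a [numClosedFieldType], [0 <= z] means that z is real and nonnegative. *)
Record ARN_hypergroup (C : numClosedFieldType) (H : falgType C) (n : nat) :=
  ARNHypergroup {
    hbasis : n.+1.-tuple H;
    hstar : 'I_n.+1 -> 'I_n.+1;
    hN := fun i j k : 'I_n.+1 =>
      coord hbasis k (tnth hbasis i * tnth hbasis j);
    h_commutative : forall a b : H, a * b = b * a;
    h_basisP : basis_of fullv hbasis;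
    h_unit : tnth hbasis ord0 = 1;
    hN_ge0 : forall i j k, 0 <= hN i j k;
    hstarK : involutive hstar;
    hN_star_gt0 : forall i, 0 < hN i (hstar i) ord0;
    hN_nstar : forall i j, j != hstar i -> hN i j ord0 = 0;
    hN_antiinvolution : forall i j k,
      hN i j k = hN (hstar j) (hstar i) (hstar k)
  }.

Section Hypergroup.
Variables (C : numClosedFieldType) (H : falgType C) (n : nat).
Variable X : ARN_hypergroup H n.
Implicit Types (i j k : 'I_n.+1) (f g : 'Hom(H, C^o)).

Definition hx i : H := tnth (hbasis X) i.

Definition hweight i : C := 1 / hN X i (hstar X i) ord0.

Definition is_alg_morphism f : Prop :=
  f 1 = 1 /\ forall a b : H, f (a * b) = f a * f b.

(* The default value [0] of [xget] is irrelevant: exactly one functional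
   satisfies the defining property. *)
Definition FPdim : 'Hom(H, C^o) :=
  xget 0 [set f | is_alg_morphism f /\ forall i, 0 < (f (hx i) : C)]%classic.

Definition hdim i : C := FPdim (hx i).

Definition is_dual_basis (mu : n.+1.-tuple 'Hom(H, C^o)) : Prop :=
  [/\ tnth mu ord0 = FPdim, uniq mu
    & forall f, f \in mu <-> is_alg_morphism f].

(* Only the position of [FPdim] in the enumeration is significant; again the
   default value of [xget] is irrelevant. *)
Definition dual_basis : n.+1.-tuple 'Hom(H, C^o) :=
  xget [tuple of nseq n.+1 0] [set mu | is_dual_basis mu]%classic.

Definition dual_mu j : 'Hom(H, C^o) := tnth dual_basis j.

Definition functional_of (v : 'I_n.+1 -> C) : 'Hom(H, C^o) :=
  linfun (fun a : H => (\sum_i coord (hbasis X) i a * v i : C^o)).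

Lemma functional_ofE v i : functional_of v (hx i) = v i.
Proof.
pose F (a : H) : C^o := \sum_i coord (hbasis X) i a * v i.
have F_lin : linear F.
  move=> c a b; rewrite /F scaler_sumr -big_split /=.
  by apply: eq_bigr => k _; rewrite linearP mulrDl -mulrA.
pose FL := GRing.isLinear.Build C H C^o _ F F_lin.
pose F' : {linear H -> C^o} := HB.pack F FL.
rewrite [LHS](lfunE F') /= /F (bigD1 i) //= big1 => [|k ki].
  rewrite /hx (tnth_nth 0) coord_free ?(basis_free (h_basisP X)) //.
  by rewrite eqxx mul1r addr0.
rewrite /hx (tnth_nth 0) coord_free ?(basis_free (h_basisP X)) //.
by rewrite eq_sym (negPf ki) mul0r.
Qed.

Definition dual_mul f g : 'Hom(H, C^o) :=
  functional_of (fun i =>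
    hdim i * (f ((hdim i)^-1 *: hx i) * g ((hdim i)^-1 *: hx i))).

Lemma dual_mulE f g i : hdim i != 0 ->
  dual_mul f g ((hdim i)^-1 *: hx i) =
    f ((hdim i)^-1 *: hx i) * g ((hdim i)^-1 *: hx i).
Proof.
by move=> d0; rewrite linearZ /= functional_ofE /GRing.scale /= mulKf.
Qed.

Definition dual_star f : 'Hom(H, C^o) :=
  functional_of (fun i => f (hx (hstar X i))).

(* The coefficient of [dual_mu k] in the product of [f] and [g]. *)
Definition dual_p k f g : C := coord dual_basis k (dual_mul f g).

Definition grouplike_dual f : Prop :=
  dual_mul f (dual_star f) = dual_p ord0 f (dual_star f) *: dual_mu ord0.

Definition dual_Burnside : Prop :=
  forall j, (exists i, dual_mu j (hx i) = 0) <-> ~ grouplike_dual (dual_mu j).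

Definition hI1 : H := \sum_i hweight i *: (hx i * hx (hstar X i)).

Definition adjoint_basis : {set 'I_n.+1} :=
  [set k | `[< exists2 r : nat, (1 <= r)%N
                              & coord (hbasis X) k (hI1 ^+ r) != 0 >]].

Definition adjoint_order : C :=
  \sum_(i in adjoint_basis) hweight i * hdim i ^+ 2.

End Hypergroup.

(* Main.v *)
(* The multiplication operators of the basis are commuting normal operators for
   the form sending [a, b] to the trace of [a b^*], hence simultaneously
   diagonalizable; so the unital algebra morphisms [f : H -> C] separate points
   and satisfy [f x_{i^*} = (f x_i)^*]. Perron-Frobenius produces FPdim, and
   [|f x_i| <= d_i] always. A character [f] is grouplike in the dual iff
   [|f x_i| = d_i] for all [i], iff [f] agrees with FPdim on the adjoint
   sub-hypergroup; by orthogonality the right-hand side of the identity, its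
   normalized Haar element, takes the value 1 at grouplike characters and 0 at
   the others. The left-hand side takes the value [prod |f x_i|^2 / d_i^2 = 1]
   at grouplike characters, and elsewhere vanishes iff some [f x_i] does. *)
From HB Require Import structures.
Require Import Defs.
From mathcomp Require Import all_boot all_order all_fingroup all_algebra all_field reals.
From mathcomp Require Import ring.
From mathcomp Require Import boolp classical_sets.
Import Order.TTheory GRing.Theory Num.Theory.
Local Open Scope ring_scope.
Set Implicit Arguments.
Unset Strict Implicit.
Unset Printing Implicit Defensive.

Section StructureConstants.
Variables (C : numClosedFieldType) (H : falgType C) (n : nat).
Variable X : ARN_hypergroup H n.
Implicit Types (i j k l : 'I_n.+1) (a b : H) (f g : 'Hom(H, C^o)).

Local Notation x := (hx X).
Local Notation h := (hweight X).
Local Notation star := (hstar X).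
Local Notation co := (coord (hbasis X)).

(** * The trace form and the structure constants *)

Definition htrace a : C := co ord0 a.
Local Notation tau := htrace.

Lemma coord_hx i k : co k (x i) = (i == k)%:R.
Proof. by rewrite /hx (tnth_nth 0) coord_free // (basis_free (h_basisP X)). Qed.

Lemma hx_expansion a : a = \sum_i co i a *: x i.
Proof.
rewrite {1}(coord_basis (h_basisP X) (memvf a)).
by apply: eq_bigr => i _; rewrite /hx (tnth_nth 0).
Qed.

Lemma hweightV i : (h i)^-1 = hN X i (star i) ord0.
Proof. by rewrite /hweight div1r invrK. Qed.

Lemma hweight_gt0 i : 0 < h i.
Proof. by rewrite -invr_gt0 hweightV hN_star_gt0. Qed.

Lemma hweight_ge0 i : 0 <= h i.
Proof. exact/ltW/hweight_gt0. Qed.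

Lemma hweight_neq0 i : h i != 0.
Proof. by rewrite gt_eqF ?hweight_gt0. Qed.

Lemma hNC i j k : hN X i j k = hN X j i k.
Proof. by rewrite /hN (h_commutative X). Qed.

Lemma hweight_star i : h (star i) = h i.
Proof. by apply: invr_inj; rewrite !hweightV hstarK hNC. Qed.

Lemma coord_hxM i j k : co k (x i * x j) = hN X i j k.
Proof. by []. Qed.

Lemma htraceM i j : tau (x i * x j) = (j == star i)%:R / h i.
Proof.
rewrite /tau coord_hxM; case: eqP => [->|/eqP ji]; first by rewrite mul1r hweightV.
by rewrite mul0r hN_nstar.
Qed.

Lemma htrace_is_linear : linear (tau : H -> C^o).
Proof. by move=> c a b; rewrite /tau linearP. Qed.
HB.instance Definition _ :=
  GRing.isLinear.Build C H C^o _ (tau : H -> C^o) htrace_is_linear.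

(** The families [x k] and [h k *: x (star k)] are dual bases for the form [tau (a * b)]. *)
Lemma coord_htrace k a : co k a = h k * tau (a * x (star k)).
Proof.
rewrite {2}(hx_expansion a) mulr_suml linear_sum /= (bigD1 k) //= big1 => [|i ik].
  rewrite addr0 -scalerAl linearZ /= htraceM eqxx mul1r.
  by rewrite /GRing.scale /= mulrCA divff ?mulr1 ?hweight_neq0.
rewrite -scalerAl linearZ /= htraceM (inj_eq (can_inj (hstarK X))).
by rewrite eq_sym (negPf ik) mul0r scaler0.
Qed.

Lemma hstar0 : star ord0 = ord0.
Proof.
apply/eqP; rewrite -[_ == _]negbK; apply/negP => s0.
have := hN_star_gt0 X ord0; rewrite -coord_hxM /hx h_unit mul1r.
by rewrite -/(hx X (star ord0)) coord_hx (negPf s0) ltxx.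
Qed.

Lemma hx0 : x ord0 = 1.
Proof. exact: h_unit. Qed.

Lemma hweight0 : h ord0 = 1.
Proof.
apply: invr_inj; rewrite hweightV hstar0 -coord_hxM hx0 mulr1 -hx0 coord_hx eqxx.
by rewrite invr1.
Qed.

(** The dual bases are inserted between the two factors; this makes [regular_mx] multiplicative. *)
Lemma htraceM_expansion a b :
  tau (a * b) = \sum_l h l * (tau (a * x (star l)) * tau (x l * b)).
Proof.
rewrite {1}(hx_expansion a) mulr_suml linear_sum /=.
apply: eq_bigr => l _; rewrite -scalerAl linearZ /= coord_htrace.
by rewrite /GRing.scale /= -mulrA.
Qed.

Lemma eq_coord a b : (forall k, co k a = co k b) -> a = b.
Proof.
by move=> ab; rewrite (hx_expansion a) (hx_expansion b); apply: eq_bigr => i _; rewrite ab.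
Qed.

Lemma coordM k a b : co k (a * b) = \sum_i \sum_j co i a * co j b * hN X i j k.
Proof.
rewrite {1}(hx_expansion a) mulr_suml linear_sum; apply: eq_bigr => i _.
rewrite {1}(hx_expansion b) mulr_sumr linear_sum; apply: eq_bigr => j _.
by rewrite -scalerAl -scalerAr !linearZ /= mulrA.
Qed.

Lemma coordM_ge0 a b : (forall k, 0 <= co k a) -> (forall k, 0 <= co k b) ->
  forall k, 0 <= co k (a * b).
Proof.
move=> a0 b0 k; rewrite coordM; apply: sumr_ge0 => i _; apply: sumr_ge0 => j _.
by rewrite !mulr_ge0 ?hN_ge0.
Qed.

Lemma coord_hx_ge0 i k : 0 <= co k (x i).
Proof. by rewrite coord_hx ler0n. Qed.

Lemma coord_starM a b : (forall k, co (star k) a = co k a) ->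
  (forall k, co (star k) b = co k b) -> forall k, co (star k) (a * b) = co k (a * b).
Proof.
move=> sa sb k; rewrite !coordM (reindex_inj (can_inj (hstarK X))).
apply: eq_bigr => i _; rewrite (reindex_inj (can_inj (hstarK X))).
by apply: eq_bigr => j _; rewrite sa sb hN_antiinvolution !hstarK hNC.
Qed.

(** Both traces are structure constants divided by a weight, and [hN_antiinvolution] matches them.
    This makes multiplication by [x (star i)] the adjoint of multiplication by [x i]. *)
Lemma htrace_starl i j k :
  tau (x (star i) * x j * x (star k)) = tau (x i * x k * x (star j)).
Proof.
have E p q r : tau (x p * x q * x (star r)) = (h r)^-1 * hN X p q r.
  by rewrite -coord_hxM coord_htrace mulKf ?hweight_neq0.
have -> : x (star i) * x j * x (star k) = x (star k) * x (star i) * x (star (star j)).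
  by rewrite hstarK (h_commutative X) mulrA.
by rewrite !E hN_antiinvolution !hstarK hweight_star.
Qed.


(** * The regular representation by normal matrices *)

(** Multiplication by [a], acting on row vectors, in the basis [sqrtC (h j) *: x j]. This basis is
    orthonormal for the Hermitian trace form, so adjoints are conjugate transposes. *)
Definition regular_mx a : 'M[C]_n.+1 :=
  \matrix_(j, k) (sqrtC (h j) * sqrtC (h k) * tau (a * x j * x (star k))).
Local Notation M := regular_mx.

Lemma regular_mxM a b : M (a * b) = M a *m M b.
Proof.
apply/matrixP => j k; rewrite !mxE.
have -> : a * b * x j * x (star k) = (a * x j) * (b * x (star k)).
  by rewrite -!mulrA (mulrA b) (h_commutative X b) -!mulrA.
rewrite htraceM_expansion mulr_sumr; apply: eq_bigr => l _; rewrite !mxE.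
have -> : x l * (b * x (star k)) = b * x l * x (star k).
  by rewrite mulrA (h_commutative X b).
by rewrite -[h l in LHS]sqrtCK; ring.
Qed.

Lemma regular_mx_is_linear : linear M.
Proof.
move=> c a b; apply/matrixP => j k; rewrite !mxE.
rewrite !mulrDl -!scalerAl linearP /= /GRing.scale /= mulrDr.
by rewrite mulrCA.
Qed.
HB.instance Definition _ :=
  GRing.isLinear.Build C H 'M[C]_n.+1 _ M regular_mx_is_linear.

(** Row [ord0] lists the coordinates of [a] up to nonzero factors. *)
Lemma regular_mx_inj a : M a = 0 -> a = 0.
Proof.
move=> /matrixP Ma0; apply: eq_coord => k; rewrite linear0 coord_htrace.
have := Ma0 ord0 k; rewrite !mxE hx0 mulr1 => /eqP.
rewrite !mulf_eq0 !sqrtC_eq0 !(negPf (hweight_neq0 _)) /= => /eqP->.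
by rewrite mulr0.
Qed.

Lemma conj_htrace_hx i j k :
  (tau (x i * x j * x (star k)))^* = tau (x i * x j * x (star k)).
Proof.
apply/CrealP/ger0_real/coordM_ge0; last exact: coord_hx_ge0.
by apply: coordM_ge0 => ?; exact: coord_hx_ge0.
Qed.

Local Open Scope sesquilinear_scope.

Lemma regular_mx_hx_adjoint i : (M (x i))^t* = M (x (star i)).
Proof.
apply/matrixP => j k; rewrite !mxE !rmorphM /= conj_htrace_hx htrace_starl.
have s l : (sqrtC (h l))^* = sqrtC (h l).
  by apply/CrealP/ger0_real; rewrite sqrtC_ge0 ltW ?hweight_gt0.
by rewrite !s (mulrC (sqrtC (h k))).
Qed.

Lemma regular_mx_hx_normal i : M (x i) \is normalmx.
Proof.
by apply/normalmxP; rewrite regular_mx_hx_adjoint -!regular_mxM (h_commutative X).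
Qed.

Lemma normal_diagonalizable (A : 'M[C]_n.+1) : A \is normalmx -> diagonalizable A.
Proof.
move=> /orthomx_spectralP EA; exists (spectralmx A); first exact: spectral_unit.
apply/(diagonalizable_forLR (spectral_unit A)); exists (spectral_diag A).
by rewrite mxpoly.conjVmx ?spectral_unit.
Qed.

(** Commuting diagonalizable matrices share a diagonalizing [P], whose rows are joint left
    eigenvectors. *)
Lemma regular_mx_codiag :
  exists2 P : 'M[C]_n.+1, P \in unitmx &
    forall i, exists d : 'rV[C]_n.+1, P *m M (x i) = diag_mx d *m P.
Proof.
have [|P Pu /allP PD] := (codiagonalizableP [seq M (x i) | i : 'I_n.+1]).1.
  split=> [_ _ /mapP[i _ ->] /mapP[j _ ->]|_ /mapP[i _ ->]].
    by rewrite /comm_mx -!regular_mxM (h_commutative X).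
  exact/normal_diagonalizable/regular_mx_hx_normal.
exists P => // i.
have /PD /diagonalizable_forPex [d /(simmxP Pu) Ed] : M (x i) \in [seq M (x i) | i : 'I_n.+1].
  by apply/mapP; exists i; rewrite ?mem_enum.
by exists d.
Qed.

(** * Characters, their idempotents and separation of points *)

Lemma lfun_coordE f (v : 'I_n.+1 -> C) a :
  (forall i, f (x i) = v i) -> f a = \sum_i co i a * v i.
Proof.
move=> fv; rewrite {1}(hx_expansion a) linear_sum; apply: eq_bigr => i _.
by rewrite linearZ /= fv.
Qed.

(** There are as many characters as basis elements, so separation makes the square table of their
    values invertible. *)
Definition separating_characters (nu : 'I_n.+1 -> 'Hom(H, C^o)) : Prop :=
  (forall r, is_alg_morphism (nu r)) /\ (forall a, (forall r, nu r a = 0) -> a = 0).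

(* Each row of the diagonalizing matrix is a joint eigenvector [v] of the
   normal matrices [M (x i)]; comparing [v M v^*] with [v M^* v^*] shows that
   adjoints have conjugate eigenvalues. *)
Lemma separating_characters_exist : exists2 nu, separating_characters nu &
  forall r i, (nu r (x (star i)) : C) = (nu r (x i))^*.
Proof.
have [P Pu /choice [d PM]] := regular_mx_codiag.
(* [d i ord0 r] is the eigenvalue of [M (x i)] on row [r] of [P]. *)
pose nu r : 'Hom(H, C^o) := functional_of X (fun i => d i ord0 r).
have rowP r a : row r P *m M a = (nu r a : C) *: row r P.
  rewrite (lfun_coordE (v := fun i => d i ord0 r)) => [|i]; last exact: functional_ofE.
  rewrite {1}(hx_expansion a) linear_sum mulmx_sumr scaler_suml.
  apply: eq_bigr => i _; rewrite linearZ /= -scalemxAr -row_mul PM.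
  by rewrite row_mul row_diag_mx -scalemxAl -rowE scalerA.
have rowP_neq0 r : row r P != 0.
  apply/eqP => Pr0; move: Pu; rewrite -row_free_unit -kermx_eq0 => /eqP K0.
  have : (delta_mx 0 r : 'rV[C]_n.+1) *m P = 0 by rewrite -rowE.
  move=> /eqP; rewrite -sub_kermx K0 submx0 => /eqP /matrixP/(_ 0 r).
  by rewrite !mxE !eqxx => /eqP; rewrite oner_eq0.
have scalI r (c c' : C) : c *: row r P = c' *: row r P -> c = c'.
  move=> /eqP; rewrite -subr_eq0 -scalerBl scaler_eq0 subr_eq0 (negPf (rowP_neq0 r)) orbF.
  by move/eqP.
exists nu; first split.
- move=> r; split=> [|a b].
    rewrite -hx0 functional_ofE; apply: (scalI r); rewrite scale1r.
    have := rowP r 1; have -> : M 1 = 1%:M.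
      apply/matrixP => j k; rewrite !mxE mul1r htraceM (inj_eq (can_inj (hstarK X))).
      rewrite eq_sym; case: eqP => [->|_]; last by rewrite mul0r mulr0.
      by rewrite mul1r -expr2 sqrtCK divff ?hweight_neq0.
    by rewrite mulmx1 -hx0 functional_ofE => <-.
  apply: (scalI r); rewrite -rowP regular_mxM mulmxA rowP -scalemxAl rowP.
  by rewrite scalerA.
- move=> a nua0; apply: regular_mx_inj; rewrite -[M a](mulKmx Pu).
  suff -> : P *m M a = 0 by rewrite mulmx0.
  by apply/row_matrixP => r; rewrite row_mul rowP nua0 scale0r row0.
move=> r i; pose v := row r P.
have vv : v *m v^t* = (dotmx v v)%:M by rewrite dotmxE -mx11_scalar.
have vv0 : dotmx v v != 0 by rewrite dnorm_eq0 rowP_neq0.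
have E : (v *m M (x i) *m v^t*)^t* = v *m M (x (star i)) *m v^t*.
  rewrite -regular_mx_hx_adjoint !trmx_mul !map_mxM /= -mulmxA.
  by rewrite trmxCK.
move: E; rewrite !rowP -!scalemxAl vv !scale_scalar_mx.
move=> /matrixP/(_ 0 0); rewrite !mxE eqxx !mulr1n rmorphM /=.
have -> : (dotmx v v)^* = dotmx v v.
  by apply/CrealP/ger0_real; rewrite dnorm_ge0.
by move/(mulIf vv0).
Qed.

(** The rows of the inverse of the character table [U] are the coordinates of the idempotents. *)
Lemma dual_idempotents nu : separating_characters nu ->
  exists e : 'I_n.+1 -> H, forall r s, (nu s (e r) : C) = (s == r)%:R.
Proof.
move=> [_ nu_sep].
pose U : 'M[C]_n.+1 := \matrix_(i, r) nu r (x i).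
have nuE r a : (nu r a : C) = \sum_i co i a * U i r.
  by apply: lfun_coordE => i; rewrite mxE.
pose el (v : 'rV[C]_n.+1) : H := \sum_i v 0 i *: x i.
have coel v i : co i (el v) = v 0 i.
  rewrite linear_sum (bigD1 i) //= linearZ /= coord_hx eqxx mulr1 big1 ?addr0 // => j ji.
  by rewrite linearZ /= coord_hx (negPf ji) mulr0.
have nuel r v : (nu r (el v) : C) = (v *m U) 0 r.
  by rewrite nuE mxE; apply: eq_bigr => i _; rewrite coel.
have Uu : U \in unitmx.
  rewrite -row_free_unit; apply: inj_row_free => v vU0; apply/rowP => i.
  rewrite -coel (nu_sep (el v)) ?linear0 ?mxE // => r.
  by rewrite [LHS]nuel vU0 mxE.
exists (fun r => el (row r (invmx U))) => r s.
by rewrite nuel -row_mul mulVmx // !mxE eq_sym.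
Qed.

Lemma mul_dual_idempotent nu (e : 'I_n.+1 -> H) : separating_characters nu ->
  (forall r s, (nu s (e r) : C) = (s == r)%:R) ->
  forall r a, a * e r = (nu r a : C) *: e r.
Proof.
move=> [nuM nu_sep] nue r a.
apply/eqP; rewrite -subr_eq0; apply/eqP/nu_sep => s.
rewrite linearB linearZ /= (nuM s).2 [nu s (e r)]nue /GRing.scale /=.
by case: eqP => [->|_]; rewrite ?mulr1 ?mulr0 subrr.
Qed.

(** Since [1] is the sum of the [e r], some [f (e r)] is nonzero. Applying [f] to
    [a * e r = nu r a *: e r] and cancelling [f (e r)] gives [f = nu r]. *)
Lemma alg_morphism_separating nu f : separating_characters nu ->
  is_alg_morphism f -> exists r, f = nu r.
Proof.
move=> nuP [f1 fM]; have [e nue] := dual_idempotents nuP.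
have [nuM nu_sep] := nuP.
have eP := mul_dual_idempotent nuP nue.
have sum_e : (1 : H) = \sum_r e r.
  apply/eqP; rewrite -subr_eq0; apply/eqP/nu_sep => s.
  rewrite linearB linear_sum /= (nuM s).1 (bigD1 s) //= [nu s (e s)]nue eqxx.
  by rewrite big1 ?addr0 ?subrr // => r rs; rewrite [LHS]nue eq_sym (negPf rs).
have [r fr0] : exists r, (f (e r) : C) != 0.
  apply/existsP; apply: contraT; rewrite negb_exists => /forallP f0.
  have := oner_neq0 C; rewrite -f1 sum_e linear_sum big1 ?eqxx // => r _.
  by apply/eqP; have := f0 r; rewrite negbK.
exists r; apply/lfunP => a; apply: (mulIf fr0).
by rewrite -fM eP linearZ.
Qed.

Lemma alg_morphism_star f i : is_alg_morphism f -> (f (x (star i)) : C) = (f (x i))^*.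
Proof.
have [nu nuP nu_star] := separating_characters_exist.
by move=> /(alg_morphism_separating nuP)[r ->].
Qed.

Lemma alg_morphism_eq0 a : (forall f, is_alg_morphism f -> f a = 0) -> a = 0.
Proof.
have [nu [nuM nu_sep] _] := separating_characters_exist.
by move=> a0; apply: nu_sep => r; apply/a0/nuM.
Qed.

Lemma alg_morphism_idempotent f : is_alg_morphism f ->
  exists e : H, forall g, is_alg_morphism g -> (g e : C) = (g == f)%:R.
Proof.
have [nu nuP _] := separating_characters_exist.
have [e nue] := dual_idempotents nuP.
move=> /(alg_morphism_separating nuP)[r ->]; exists (e r).
move=> g /(alg_morphism_separating nuP)[s ->]; rewrite nue.
(* Distinct indices give distinct characters, because [e r] takes the value 1 only at index [r]. *)
congr (nat_of_bool _)%:R; apply/eqP/eqP => [-> //|snr].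
have := nue r s; rewrite snr nue eqxx; case: eqP => // _ /eqP.
by rewrite oner_eq0.
Qed.

(* Perron-Frobenius. Let [S] be the sum of the basis, let [r] maximize the real
   number [lam = nu r S], and let [c] be the coordinates of the idempotent of [r].
   Replacing [c] by [|c|] does not decrease the form [c |-> tau (c^* S c)], whose
   maximum on vectors of the norm of [c] is attained at [c]; so [w], with
   coordinates [|c|], is again an eigenvector of [S]. Comparing coefficients in
   [S w = lam w] gives [sum |nu r (x i)| = lam = sum nu r (x i)]. *)
Lemma FPdim_exists :
  exists f : 'Hom(H, C^o), is_alg_morphism f /\ forall i, 0 < (f (x i) : C).
Proof.
have [nu nuP nu_star] := separating_characters_exist.
have [e nue] := dual_idempotents nuP; have [nuM nu_sep] := nuP.
have eP := mul_dual_idempotent nuP nue.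
(* The trace is a combination of the characters, with weights that [t_gt0] shows to be positive. *)
have tau_nu a : tau a = \sum_s tau (e s) * nu s a.
  suff {1}-> : a = \sum_s (nu s a : C) *: e s.
    by rewrite linear_sum; apply: eq_bigr => s _; rewrite linearZ /= mulrC.
  apply/eqP; rewrite -subr_eq0; apply/eqP/nu_sep => s.
  rewrite linearB linear_sum (bigD1 s) //= big1 ?addr0 => [|i si];
    rewrite linearZ /= [nu s (e _)]nue.
    by rewrite eqxx /GRing.scale /= mulr1 subrr.
  by rewrite eq_sym (negPf si) scaler0.
pose el (c : 'I_n.+1 -> C) : H := \sum_i c i *: x i.
have coel c i : co i (el c) = c i.
  rewrite linear_sum (bigD1 i) //= linearZ /= coord_hx eqxx mulr1 big1 ?addr0 // => j ji.
  by rewrite linearZ /= coord_hx (negPf ji) mulr0.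
have nuel c s : (nu s (el c) : C) = \sum_i c i * nu s (x i).
  by rewrite linear_sum; apply: eq_bigr => i _; rewrite linearZ.
(* The characters diagonalize this form in [q_nu]; for [y = 1] the basis also diagonalizes it, in
   [q1]. *)
pose q y (c : 'I_n.+1 -> C) := \sum_i \sum_j (c i)^* * c j * tau (x (star i) * y * x j).
have q_nu y c : q y c = \sum_s tau (e s) * nu s y * `|nu s (el c) : C| ^+ 2.
  transitivity (\sum_i \sum_j \sum_s
    tau (e s) * nu s y * (((c i)^* * (nu s (x i) : C)^*) * (c j * nu s (x j)))).
    apply: eq_bigr => i _; apply: eq_bigr => j _; rewrite tau_nu mulr_sumr.
    apply: eq_bigr => s _; rewrite !(nuM s).2 nu_star; ring.
  under eq_bigr => i _ do rewrite exchange_big.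
  rewrite exchange_big; apply: eq_bigr => s _.
  rewrite normCKC nuel rmorph_sum big_distrl mulr_sumr; apply: eq_bigr => i _.
  by rewrite big_distrr mulr_sumr; apply: eq_bigr => j _; rewrite rmorphM.
have q1 c : q 1 c = \sum_i `|c i| ^+ 2 / h i.
  apply: eq_bigr => i _; rewrite (bigD1 i) //= big1 ?addr0 => [|j ji].
    by rewrite mulr1 htraceM hstarK eqxx hweight_star normCKC mul1r.
  by rewrite mulr1 htraceM hstarK (negPf ji) mul0r mulr0.
pose S : H := \sum_i x i.
have nuS s : (nu s S : C) \is Num.real.
  apply/CrealP; rewrite linear_sum rmorph_sum (reindex_inj (can_inj (hstarK X))) /=.
  by apply: eq_bigr => i _; rewrite nu_star conjCK.
have q_e r y : q y (fun i => co i (e r)) = tau (e r) * nu r y.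
  rewrite q_nu (bigD1 r) //= /el -hx_expansion [nu r (e r)]nue eqxx normr1 expr1n mulr1.
  rewrite big1 ?addr0 // => s sr.
  by rewrite [nu s (e r)]nue (negPf sr) normr0 expr0n mulr0.
(* [tau (e r)] is the value of [q 1] at the coordinates of the nonzero element [e r]. *)
have t_gt0 r : 0 < tau (e r).
  have := q_e r 1; rewrite (nuM r).1 mulr1 q1 => <-.
  rewrite lt_def sumr_ge0 ?andbT => [|i _]; last by rewrite divr_ge0 ?exprn_ge0 // ltW ?hweight_gt0.
  apply/negP; rewrite psumr_eq0 => [/allP c0|i _]; last first.
    by rewrite divr_ge0 ?exprn_ge0 // ltW ?hweight_gt0.
  have := nue r r; suff -> : e r = 0 by rewrite linear0 eqxx => /esym/eqP; rewrite oner_eq0.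
  apply: eq_coord => i; rewrite linear0; have := c0 i (mem_index_enum i).
  by rewrite /= mulf_eq0 invr_eq0 (negPf (hweight_neq0 i)) orbF expf_eq0 normr_eq0 => /eqP.
have [r _ r_max] := @real_arg_maxP C _ ord0 xpredT (fun s => nu s S : C) isT (in1W nuS).
pose lam : C := nu r S; pose t := tau (e r); pose w := el (fun i => `|co i (e r)|).
have Sw : S * w = lam *: w.
  have gap_ge0 s : 0 <= tau (e s) * (lam - nu s S) * `|nu s w : C| ^+ 2.
    by rewrite !mulr_ge0 ?exprn_ge0 ?(ltW (t_gt0 _)) // subr_ge0; exact: r_max.
  (* The sum is [lam * q 1 - q S] at the absolute values of the coordinates. Passing to them
     preserves [q 1] and does not decrease [q S], so the sum is at most 0; by [gap_ge0] every term
     then vanishes. *)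
  have gap : \sum_s tau (e s) * (lam - nu s S) * `|nu s w : C| ^+ 2 = 0.
    apply/eqP; rewrite eq_le sumr_ge0 ?andbT //.
    have -> : \sum_s tau (e s) * (lam - nu s S) * `|nu s w : C| ^+ 2 =
        lam * q 1 (fun i => `|co i (e r)|) - q S (fun i => `|co i (e r)|).
      rewrite !q_nu mulr_sumr -sumrB; apply: eq_bigr => s _.
      by rewrite (nuM s).1 mulr1; ring.
    have -> : q 1 (fun i => `|co i (e r)|) = tau (e r).
      rewrite q1 -[RHS]mulr1 -(nuM r).1 -q_e q1.
      by apply: eq_bigr => i _; rewrite normr_id.
    rewrite subr_le0 mulrC -q_e.
    have qreal : q S (fun i => co i (e r)) \is Num.real.
      by rewrite q_e rpredM ?nuS ?ger0_real ?ltW.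
    apply: le_trans (real_ler_norm qreal) _.
    apply: le_trans (ler_norm_sum _ _ _) _; apply: ler_sum => i _.
    apply: le_trans (ler_norm_sum _ _ _) _; apply: ler_sum => j _.
    rewrite !normrM norm_conjC (CrealP (normr_real _)) [`|tau _|]ger0_norm //.
    apply: coordM_ge0; last exact: coord_hx_ge0.
    apply: coordM_ge0; first exact: coord_hx_ge0.
    by move=> k; rewrite linear_sum; apply: sumr_ge0 => l _; exact: coord_hx_ge0.
  apply/eqP; rewrite -subr_eq0; apply/eqP/nu_sep => s.
  rewrite linearB linearZ /= (nuM s).2 /GRing.scale /= -mulrBl.
  have /eqP : tau (e s) * (lam - nu s S) * `|nu s w : C| ^+ 2 = 0.
    by apply: (psumr_eq0P _ gap).
  rewrite !mulf_eq0 (gt_eqF (t_gt0 s)) orbb normr_eq0 /= subr_eq0.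
  by case/orP => /eqP E; [rewrite E subrr mul0r | rewrite [nu s w]E mulr0].
have cE i : co i (e r) = h i * t * (nu r (x i) : C)^*.
  by rewrite coord_htrace mulrC (h_commutative X) eP linearZ /= nu_star /GRing.scale /= /t; ring.
have coSw k : co k (S * w) = \sum_j `|co j (e r)| * co k (S * x j).
  by rewrite mulr_sumr linear_sum; apply: eq_bigr => j _; rewrite -scalerAr linearZ.
have nu1 : (nu r (x ord0) : C) = 1 by rewrite hx0 (nuM r).1.
have c0 : `|co ord0 (e r)| = t.
  by rewrite cE nu1 rmorph1 hweight0 mul1r mulr1 ger0_norm // ltW ?t_gt0.
have coSx_ge0 k j : 0 <= co k (S * x j).
  apply: coordM_ge0; last exact: coord_hx_ge0.
  by move=> l; rewrite linear_sum; apply: sumr_ge0 => i _; exact: coord_hx_ge0.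
(* Otherwise coefficient [k] of [lam *: w] would be 0, while in [S * w] the term [j = ord0] is
   already positive. *)
have v_neq0 k : (nu r (x k) : C) != 0.
  apply/eqP => vk0; have := coSw k; rewrite Sw linearZ /= coel cE vk0 rmorph0 mulr0 normr0 mulr0.
  move/esym; apply/eqP; rewrite gt_eqF // (bigD1 ord0) //= ltr_wpDr //.
    by apply: sumr_ge0 => j _; rewrite mulr_ge0.
  rewrite c0 hx0 mulr1 mulr_gt0 ?t_gt0 // linear_sum (bigD1 k) //= coord_hx eqxx.
  by rewrite ltr_wpDr ?ltr01 //; apply: sumr_ge0 => j _; exact: coord_hx_ge0.
have sum_abs : \sum_j `|nu r (x j) : C| = \sum_j nu r (x j).
  have tS j : tau (S * x j) = (h j)^-1.
    rewrite mulr_suml linear_sum (bigD1 (star j)) //= htraceM hstarK eqxx mul1r hweight_star.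
    rewrite big1 ?addr0 // => i ij; rewrite htraceM -(inj_eq (can_inj (hstarK X))) hstarK.
    by rewrite eq_sym (negPf ij) mul0r.
  have := coSw ord0; rewrite Sw linearZ /= coel c0 /lam linear_sum /= => E.
  apply/esym/(mulIf (lt0r_neq0 (t_gt0 r))); rewrite [LHS]E mulr_suml.
  apply: eq_bigr => j _; rewrite cE -/(tau (S * x j)) tS normrM normrM norm_conjC.
  rewrite (ger0_norm (ltW (hweight_gt0 j))) (ger0_norm (ltW (t_gt0 r))).
  by rewrite -/t; field; rewrite hweight_neq0.
exists (nu r); split=> // i.
(* A sum that equals the sum of its absolute values has only nonnegative terms. *)
have -> : (nu r (x i) : C) = `|nu r (x i) : C|.
  pose F j : C := nu r (x j); pose G j := `|F j|.
  exact: (@normC_sum_upper C _ xpredT F G (fun _ _ => lexx _) (esym sum_abs)).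
by rewrite normr_gt0.
Qed.

(** * The Frobenius-Perron character and the dual basis *)

Lemma FPdimP : is_alg_morphism (FPdim X) /\ forall i, 0 < hdim X i.
Proof.
pose P := [set f : 'Hom(H, C^o) | is_alg_morphism f /\ forall i, 0 < (f (x i) : C)]%classic.
by have [f fP] := FPdim_exists; apply: (@xgetPex _ 0 P); exists f.
Qed.

Local Notation d := (hdim X).

Lemma hdim_gt0 i : 0 < d i. Proof. by have [] := FPdimP. Qed.

Lemma hdim_ge0 i : 0 <= d i. Proof. exact/ltW/hdim_gt0. Qed.

Lemma hdim_neq0 i : d i != 0. Proof. by rewrite gt_eqF ?hdim_gt0. Qed.

Lemma hdim_star i : d (star i) = d i.
Proof.
rewrite /hdim alg_morphism_star; last exact: FPdimP.1.
exact/CrealP/ger0_real/ltW/hdim_gt0.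
Qed.

Lemma dual_basisP : is_dual_basis X (dual_basis X).
Proof.
apply: (@xgetPex _ _ [set mu | is_dual_basis X mu]%classic).
have [nu nuP _] := separating_characters_exist; have [e nue] := dual_idempotents nuP.
have [r0 Er0] := alg_morphism_separating nuP FPdimP.1.
(* The transposition moves [FPdim] to index [ord0]. *)
exists [tuple nu (tperm ord0 r0 i) | i < n.+1]; split.
- by rewrite tnth_mktuple tpermL.
- rewrite map_inj_uniq ?enum_uniq // => i j /= nuij; apply: (@perm_inj _ (tperm ord0 r0)).
  have := nue (tperm ord0 r0 i) (tperm ord0 r0 j).
  by rewrite -nuij nue eqxx; case: eqP => // _ /eqP; rewrite oner_eq0.
move=> f; split=> [/mapP[i _ ->]|/(alg_morphism_separating nuP)[r ->]]; first exact: nuP.1.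
by apply/mapP; exists (tperm ord0 r0 r); rewrite ?mem_enum // tpermK.
Qed.

Lemma dual_mu_morphism j : is_alg_morphism (dual_mu X j).
Proof. by have [_ _ muP] := dual_basisP; apply/muP/mem_tnth. Qed.

Lemma dual_muP f : is_alg_morphism f -> exists j, f = dual_mu X j.
Proof. by have [_ _ muP] := dual_basisP; move=> /muP/tnthP. Qed.

Lemma dual_mu0 : dual_mu X ord0 = FPdim X.
Proof. by have [] := dual_basisP. Qed.

(** Evaluating a linear relation at the idempotent of one character isolates its coefficient. *)
Lemma free_dual_basis : free (dual_basis X).
Proof.
apply/freeP => c c0 i; have [e eP] := alg_morphism_idempotent (dual_mu_morphism i).
have [_ /tuple_uniqP mu_inj _] := dual_basisP.
have := congr1 (fun f : 'Hom(H, C^o) => (f e : C)) c0.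
rewrite /= sum_lfunE zero_lfunE (bigD1 i) //= big1 ?addr0 => [|j ji]; rewrite scale_lfunE -tnth_nth.
  by rewrite [_ e]eP ?eqxx ?[LHS]mulr1 //; exact: dual_mu_morphism.
rewrite [_ e]eP; last exact: dual_mu_morphism.
by rewrite (inj_eq mu_inj) (negPf ji) scaler0.
Qed.

Lemma lfun_hx f g : (forall i, f (x i) = g (x i)) -> f = g.
Proof.
move=> fg; apply/lfunP => a; rewrite (hx_expansion a) !linear_sum.
by apply: eq_bigr => i _; rewrite !linearZ /= fg.
Qed.

(** At [x i] the product of [f] with its star is the squared absolute value of [f (x i)] divided by
    [d i]. If it is a multiple of [FPdim], evaluation at [1] shows that the factor is 1. *)
Lemma grouplike_dualP f : is_alg_morphism f ->
  grouplike_dual X f <-> forall i, `|f (x i) : C| = d i.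
Proof.
move=> fM.
have ffE i : (dual_mul X f (dual_star X f) (x i) : C) = `|f (x i) : C| ^+ 2 / d i.
  rewrite functional_ofE !linearZ /= functional_ofE alg_morphism_star // normCK.
  rewrite /GRing.scale /=; field; exact: hdim_neq0.
rewrite /grouplike_dual dual_mu0; split=> [E i|fd].
  have p1 : dual_p X ord0 f (dual_star X f) = 1.
    have := congr1 (fun g : 'Hom(H, C^o) => (g 1 : C)) E.
    rewrite /= scale_lfunE FPdimP.1.1 [LHS]/= => E1; rewrite -[LHS]mulr1 -[LHS]E1.
    by rewrite -hx0 ffE /hdim hx0 fM.1 FPdimP.1.1 normr1 expr1n divr1.
  have := ffE i; rewrite E p1 scale1r -/(hdim X i) => /esym/(canRL (mulfVK (hdim_neq0 i))).
  by rewrite -expr2 => /eqP; rewrite eqrXn2 ?normr_ge0 ?ltW ?hdim_gt0 // => /eqP.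
have ffd : dual_mul X f (dual_star X f) = FPdim X.
  apply: lfun_hx => i; rewrite [LHS]ffE fd expr2 mulfK //; exact: hdim_neq0.
rewrite /dual_p ffd -dual_mu0 /dual_mu (tnth_nth 0).
by rewrite coord_free ?free_dual_basis // scale1r.
Qed.

Lemma alg_morphismE f a : (f a : C) = \sum_i co i a * f (x i).
Proof. exact: lfun_coordE. Qed.

(** * Regular elements of sub-hypergroups and the bound by [FPdim] *)

(** This is coefficient [k] of the eigenvector equation in [regular_element]. For [k] in [A], the
    symmetry [hNE] turns the left side into [h k] times an expansion of [FPdim (x i * x (star k))],
    which is [d i * d k]. *)
Lemma sum_regular (A : {set 'I_n.+1}) i k :
  (forall j, j \in A -> star j \in A) ->
  (forall j l m, j \in A -> l \in A -> hN X j l m != 0 -> m \in A) ->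
  i \in A ->
  \sum_(j in A) h j * d j * hN X i j k = d i * (if k \in A then h k * d k else 0).
Proof.
move=> Astar AM iA.
case: ifPn => kA; last first.
  rewrite mulr0 big1 // => j jA; case: (eqVneq (hN X i j k) 0) => [->|/(AM _ _ _ iA jA)].
    by rewrite mulr0.
  by rewrite (negPf kA).
have hNE j : h j * hN X i j k = h k * hN X i (star k) (star j).
  rewrite -!coord_hxM !coord_htrace hstarK hweight_star.
  have -> : x i * x j * x (star k) = x i * x (star k) * x j.
    by rewrite -!mulrA (h_commutative X (x j)).
  by ring.
rewrite (eq_bigr (fun j => h k * (d j * hN X i (star k) (star j)))) => [|j _]; last first.
  by rewrite mulrAC hNE; ring.
rewrite -mulr_sumr mulrCA; congr (_ * _); rewrite -(hdim_star k) /hdim -FPdimP.1.2.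
rewrite [RHS]alg_morphismE [RHS](reindex_inj (can_inj (hstarK X))) /=.
(* By closure, [x i * x (star k)] is supported on [A], so the full expansion reduces to a sum over
   [A]. *)
rewrite [RHS](bigID (mem A)) /= [X in _ = _ + X]big1 ?addr0 => [|j jA].
  by apply: eq_bigr => j _; rewrite coord_hxM mulrC -/(d (star j)) hdim_star.
case: (eqVneq (hN X i (star k) (star j)) 0) => [E|/(AM _ _ _ iA (Astar _ kA))/Astar].
  by rewrite coord_hxM E mul0r.
by rewrite hstarK (negPf jA).
Qed.

(** Consequently a character with [f (x i) != d i] for some [i] in [A] vanishes on this sum. *)
Lemma regular_element (A : {set 'I_n.+1}) i :
  (forall j, j \in A -> star j \in A) ->
  (forall j l m, j \in A -> l \in A -> hN X j l m != 0 -> m \in A) ->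
  i \in A ->
  x i * (\sum_(j in A) (h j * d j) *: x j) = d i *: (\sum_(j in A) (h j * d j) *: x j).
Proof.
move=> Astar AM iA; apply: eq_coord => k; rewrite linearZ mulr_sumr !linear_sum /=.
under eq_bigr => j _ do rewrite -scalerAr linearZ /= coord_hxM.
rewrite sum_regular //; congr (_ * _); case: ifPn => kA.
  rewrite (bigD1 k) //= linearZ /= coord_hx eqxx mulr1 big1 ?addr0 // => j /andP[_ jk].
  by rewrite linearZ /= coord_hx (negPf jk) mulr0.
rewrite big1 // => j jA; rewrite linearZ /= coord_hx.
by case: eqP jA => [->|]; rewrite ?(negPf kA) ?mulr0.
Qed.

(** Expand [f (x i * x j)], apply the triangle inequality, and sum over [j] with weights
    [h j * d j]. By [sum_regular] on the whole basis the bound is [d i * T], and the positive factor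
    [T] cancels. *)
Lemma alg_morphism_le_hdim f i : is_alg_morphism f -> `|f (x i) : C| <= d i.
Proof.
move=> fM; pose T := \sum_j h j * d j * `|f (x j) : C|.
have hd_ge0 j : 0 <= h j * d j := mulr_ge0 (hweight_ge0 j) (hdim_ge0 j).
have term_ge0 j : 0 <= h j * d j * `|f (x j) : C| := mulr_ge0 (hd_ge0 j) (normr_ge0 _).
have T_gt0 : 0 < T.
  rewrite /T (bigD1 ord0) //= ltr_wpDr //; first by apply: sumr_ge0.
  by rewrite hx0 fM.1 normr1 mulr1 hweight0 mul1r hdim_gt0.
rewrite -(ler_pM2r T_gt0).
have E k : \sum_j h j * d j * hN X i j k = d i * (h k * d k).
  have := @sum_regular [set: 'I_n.+1] i k (fun _ _ => finset.in_setT _)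
    (fun _ _ _ _ _ _ => finset.in_setT _) (finset.in_setT _).
  by rewrite finset.in_setT => <-; apply: eq_bigl => j; rewrite finset.in_setT.
have -> : d i * T = \sum_j h j * d j * \sum_k hN X i j k * `|f (x k) : C|.
  transitivity (\sum_k (\sum_j h j * d j * hN X i j k) * `|f (x k) : C|).
    by rewrite mulr_sumr; apply: eq_bigr => k _; rewrite E; ring.
  under eq_bigr => k _ do rewrite mulr_suml.
  rewrite exchange_big; apply: eq_bigr => j _; rewrite mulr_sumr.
  by apply: eq_bigr => k _; rewrite mulrA.
rewrite mulr_sumr; apply: ler_sum => j _; rewrite mulrCA.
rewrite ler_wpM2l //.
rewrite -normrM -fM.2 alg_morphismE; apply: le_trans (ler_norm_sum _ _ _) _.
by apply: ler_sum => k _; rewrite normrM ger0_norm // hN_ge0.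
Qed.

(** * The adjoint sub-hypergroup *)

Local Notation A := (adjoint_basis X).
Local Notation I1 := (hI1 X).

Lemma mem_adjoint_basisP k :
  reflect (exists2 r : nat, (1 <= r)%N & co k (I1 ^+ r) != 0) (k \in A).
Proof. by rewrite /adjoint_basis finset.inE; exact: asboolP. Qed.

Lemma coord_hI1 k : co k I1 = \sum_i h i * hN X i (star i) k.
Proof. by rewrite linear_sum; apply: eq_bigr => i _; rewrite linearZ /= coord_hxM. Qed.

Lemma coord_hI1X_ge0 r k : 0 <= co k (I1 ^+ r).
Proof.
elim: r k => [|r IH]; first by rewrite expr0 -hx0; exact: coord_hx_ge0.
rewrite exprS; apply: coordM_ge0 => // k; rewrite coord_hI1; apply: sumr_ge0 => i _.
exact: mulr_ge0 (hweight_ge0 i) (hN_ge0 X _ _ _).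
Qed.

Lemma coord_hI1X_star r k : co (star k) (I1 ^+ r) = co k (I1 ^+ r).
Proof.
elim: r k => [|r IH] k.
  by rewrite expr0 -hx0 !coord_hx -(inj_eq (can_inj (hstarK X))) hstarK hstar0.
rewrite exprS; apply: coord_starM => // {}k; rewrite !coord_hI1.
by apply: eq_bigr => i _; rewrite hN_antiinvolution !hstarK.
Qed.

Lemma adjoint_basis_star k : k \in A -> star k \in A.
Proof.
move=> /mem_adjoint_basisP[r r1 kr]; apply/mem_adjoint_basisP; exists r => //.
by rewrite coord_hI1X_star.
Qed.

(** The two witnessing powers multiply, and nonnegative coordinates cannot cancel, so the term of
    [i] and [j] survives. *)
Lemma adjoint_basis_mul i j k : i \in A -> j \in A -> hN X i j k != 0 -> k \in A.
Proof.
move=> /mem_adjoint_basisP[r r1 ir] /mem_adjoint_basisP[s s1 js] ijk.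
apply/mem_adjoint_basisP; exists (r + s)%N; first by rewrite addn_gt0 r1.
have term_ge0 p q : 0 <= co p (I1 ^+ r) * co q (I1 ^+ s) * hN X p q k.
  by apply: mulr_ge0 (mulr_ge0 _ _) (hN_ge0 X _ _ _); exact: coord_hI1X_ge0.
rewrite exprD coordM gt_eqF // (bigD1 i) //= (bigD1 j) //=.
have sum1 : 0 <= \sum_(q | q != j) co i (I1 ^+ r) * co q (I1 ^+ s) * hN X i q k.
  exact: sumr_ge0.
have sum2 : 0 <= \sum_(p | p != i) \sum_q co p (I1 ^+ r) * co q (I1 ^+ s) * hN X p q k.
  by apply: sumr_ge0 => p _; exact: sumr_ge0.
apply: ltr_wpDr sum2 (ltr_wpDr sum1 _).
by rewrite lt_def term_ge0 andbT !mulf_neq0.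
Qed.

Lemma alg_morphismX f a r : is_alg_morphism f -> (f (a ^+ r) : C) = (f a : C) ^+ r.
Proof. by move=> [f1 fM]; elim: r => [|r IH]; rewrite ?expr0 // !exprS fM IH. Qed.

Lemma alg_morphism_hI1 f : is_alg_morphism f ->
  (f I1 : C) = \sum_i h i * `|f (x i) : C| ^+ 2.
Proof.
move=> fM; rewrite linear_sum; apply: eq_bigr => i _.
by rewrite linearZ /= fM.2 alg_morphism_star // normCK.
Qed.

(* Both directions use that equality holds in the triangle inequality bounding
   the value of [f] at an element with nonnegative coordinates by its FPdim. *)
Lemma abs_hdim_adjointP f : is_alg_morphism f ->
  (forall i, `|f (x i) : C| = d i) <-> (forall k, k \in A -> (f (x k) : C) = d k).
Proof.
move=> fM; have [dM _] := FPdimP; split=> [fd k /mem_adjoint_basisP[r _ kr]|fA i].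
  pose F l : C := co l (I1 ^+ r) * f (x l); pose G l : C := co l (I1 ^+ r) * d l.
  have leFG l : true -> `|F l| <= G l.
    by rewrite normrM fd ger0_norm // coord_hI1X_ge0.
  (* [f] and [FPdim] agree on [I1], where their values depend only on absolute values on the basis;
     hence they agree on its powers. *)
  have FG : \sum_l F l = \sum_l G l.
    rewrite -(alg_morphismE f) -(alg_morphismE (FPdim X)) !alg_morphismX //.
    rewrite !alg_morphism_hI1 //; congr (_ ^+ _); apply: eq_bigr => i _.
    by rewrite fd ger0_norm // hdim_ge0.
  exact: mulfI kr _ _ (normC_sum_upper leFG FG isT).
(* These sums are the values of [f] and [FPdim] on [I1], whose support lies in [A] through the power
   1. *)
pose F l : C := h l * `|f (x l) : C| ^+ 2; pose G l : C := h l * `|d l| ^+ 2.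
have leFG l : true -> `|F l| <= G l.
  move=> _; rewrite ger0_norm; last exact: mulr_ge0 (hweight_ge0 l) (exprn_ge0 _ (normr_ge0 _)).
  rewrite ler_wpM2l ?hweight_ge0 // (ger0_norm (hdim_ge0 l)).
  by rewrite lerXn2r ?nnegrE ?normr_ge0 ?hdim_ge0 ?alg_morphism_le_hdim.
have FG : \sum_l F l = \sum_l G l.
  rewrite -alg_morphism_hI1 // -[RHS](alg_morphism_hI1 dM) !alg_morphismE.
  apply: eq_bigr => k _; case: (eqVneq (co k I1) 0) => [->|k1]; first by rewrite !mul0r.
  by rewrite fA //; apply/mem_adjoint_basisP; exists 1%N.
have /(mulfI (hweight_neq0 i)) := normC_sum_upper leFG FG (i := i) isT.
by move=> /eqP; rewrite eqrXn2 // => /eqP ->; rewrite ger0_norm // hdim_ge0.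
Qed.

(** Each index contributes [h i / h i] to the coefficient of the unit in [I1], which is therefore
    [n.+1]. *)
Lemma mem_adjoint_basis0 : ord0 \in A.
Proof.
apply/mem_adjoint_basisP; exists 1%N => //; rewrite expr1 coord_hI1.
under eq_bigr => i _ do rewrite -hweightV divff ?hweight_neq0 //.
by rewrite sumr_const card_ord pnatr_eq0.
Qed.

Lemma adjoint_order_gt0 : 0 < adjoint_order X.
Proof.
rewrite /adjoint_order (bigD1 ord0) ?mem_adjoint_basis0 //=.
apply: ltr_wpDr.
  by apply: sumr_ge0 => i _; exact: mulr_ge0 (hweight_ge0 i) (exprn_ge0 _ (hdim_ge0 i)).
by rewrite hweight0 mul1r exprn_gt0 // hdim_gt0.
Qed.

(** * The Haar element and the equivalence *)

Definition adjoint_haar : H :=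
  (1 / adjoint_order X) *: \sum_(i in A) (h i * d (star i)) *: x i.

Lemma alg_morphism_adjoint_haar f : is_alg_morphism f ->
  ((forall i, `|f (x i) : C| = d i) -> (f adjoint_haar : C) = 1) /\
  (~ (forall i, `|f (x i) : C| = d i) -> (f adjoint_haar : C) = 0).
Proof.
move=> fM; rewrite abs_hdim_adjointP // /adjoint_haar linearZ /=; split=> [fA|nfA].
  rewrite linear_sum (eq_bigr (fun i => h i * d i ^+ 2 : C)) => [|i iA]; last first.
    by rewrite linearZ /= fA // hdim_star /GRing.scale /= expr2 mulrA.
  by rewrite /GRing.scale /= div1r mulVf // gt_eqF ?adjoint_order_gt0.
have [k kA fk] : exists2 k, k \in A & (f (x k) : C) != d k.
  apply: contrapT => fA; apply: nfA => k kA; apply/eqP.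
  by apply: contrapT => /negP fk; apply: fA; exists k.
under eq_bigr => i _ do rewrite hdim_star.
have /(congr1 (f : H -> C)) := regular_element adjoint_basis_star adjoint_basis_mul kA.
rewrite fM.2 linearZ /= => /eqP; rewrite -subr_eq0 -mulrBl mulf_eq0 subr_eq0 (negPf fk).
by move=> /eqP ->; rewrite scaler0.
Qed.

Lemma alg_morphism_prod f : is_alg_morphism f ->
  (f ((\prod_i ((d i)^-1 *: x i)) ^+ 2) : C) = (\prod_i ((d i)^-1 * f (x i))) ^+ 2.
Proof.
move=> fM; rewrite alg_morphismX //; congr (_ ^+ 2).
have [f1 fmul] := fM; rewrite (big_morph (f : H -> C) fmul f1).
by apply: eq_bigr => i _; rewrite linearZ.
Qed.

Lemma dual_Burnside_haar :
  dual_Burnside X <-> (\prod_i ((d i)^-1 *: x i)) ^+ 2 = adjoint_haar.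
Proof.
have prod0 f : is_alg_morphism f ->
    (exists i, f (x i) = 0) <-> (f ((\prod_i ((d i)^-1 *: x i)) ^+ 2) : C) = 0.
  move=> fM; rewrite alg_morphism_prod //; split=> [[i fi0]|/eqP].
    by rewrite (bigD1 i) //= fi0 mulr0 mul0r expr0n.
  rewrite expf_eq0 /= prodf_seq_eq0 => /hasP[i _ /=].
  by rewrite mulf_eq0 invr_eq0 (negPf (hdim_neq0 i)) => /eqP fi0; exists i.
split=> [burnside|E j]; last first.
  (* Under the identity, [prod0] detects the zeros of [f] by its value at the Haar element, which is
     1 or 0 according to whether [f] is grouplike. *)
  have fM := dual_mu_morphism j; rewrite prod0 // E grouplike_dualP //.
  have [h1 h0] := alg_morphism_adjoint_haar fM; split=> // f0 fd.
  by have := h1 fd; rewrite f0 => /esym/eqP; rewrite oner_eq0.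
(* Characters separate points, so the identity is tested on each [f]. *)
apply/eqP; rewrite -subr_eq0; apply/eqP/alg_morphism_eq0 => f fM.
rewrite linearB /=; apply/eqP; rewrite subr_eq0; apply/eqP.
have [h1 h0] := alg_morphism_adjoint_haar fM.
have [fd|nfd] := pselect (forall i, `|f (x i) : C| = d i); last first.
  rewrite h0 //; apply/prod0 => //.
  have [j Ej] := dual_muP fM; rewrite Ej; apply/burnside.
  by rewrite -Ej grouplike_dualP.
(* Pairing the factors of [i] and [i^*] turns the square into a product of
   squared absolute values. *)
rewrite h1 // alg_morphism_prod // expr2 {2}(reindex_inj (can_inj (hstarK X))) /=.
rewrite -big_split /= big1 // => i _.
rewrite alg_morphism_star // hdim_star mulrACA -normCK fd.
by rewrite -invfM -expr2 mulVf // expf_neq0 // hdim_neq0.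
Qed.

End StructureConstants.

Theorem theorem1p11 (R : realType) (H : falgType (complex R)) (n : nat)
    (X : ARN_hypergroup H n) :
  dual_Burnside X <->
  (\prod_(i < n.+1) ((hdim X i)^-1 *: hx X i)) ^+ 2 =
    (1 / adjoint_order X) *:
      (\sum_(i in adjoint_basis X)
         (hweight X i * hdim X (hstar X i)) *: hx X i).
Proof. exact: dual_Burnside_haar. Qed.
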